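(* Let $Q(\cdot)$ be a finite quasigroup and let $i,j\in Q$ be such that the tracks $\varphi_i$ and $\varphi_j$ of $Q(\cdot)$ are special. Then $\varphi_i(j)=\alpha(\varphi_i(j))$ for every $\alpha\in\mathrm{Aut}\,Q(\cdot)$.
   Context: $Q=\{1,2,\ldots,n\}$ is a finite set and $Q(\cdot)$ is a quasigroup on $Q$ (for all $a,b\in Q$ the equations $a\cdot x=b$ and $y\cdot a=b$ have unique solutions). For $i\in Q$, the track $\varphi_i$ of $Q(\cdot)$ is the permutation of $Q$ determined by $x\cdot\varphi_i(x)=i$ for all $x\in Q$. For a permutation $\varphi$ of $Q$, $Z(\varphi)$ denotes the cycle type of $\varphi$, i.e. the multiset $[k_1,\ldots,k_r]$ of the lengths of all cycles of $\varphi$ (fixed points included as cycles of length 1). A track $\varphi_k$ is called special if $Z(\varphi_k)\neq Z(\varphi_i)$ for all $i\in Q$, $i\neq k$. $\mathrm{Aut}\,Q(\cdot)$ is the group of automorphisms of $Q(\cdot)$, i.e. permutations $\alpha$ of $Q$ with $\alpha(x\cdot y)=\alpha(x)\cdot\alpha(y)$ for all $x,y\in Q$. *)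

(* Defs.v *)
From mathcomp Require Import all_boot all_fingroup.
From mathcomp Require Import finmap multiset.

Local Open Scope mset_scope.

Set Implicit Arguments.
Unset Strict Implicit.
Unset Printing Implicit Defensive.

Record quasigroup (Q : finType) := Quasigroup {
  qmul :> Q -> Q -> Q;
  qmul_lsolve : forall a b : Q, exists! x : Q, qmul a x = b;
  qmul_rsolve : forall a b : Q, exists! y : Q, qmul y a = b
}.

Section Tracks.

Variables (Q : finType) (op : quasigroup Q).

Lemma track_ex (i x : Q) : exists y : Q, op x y == i.
Proof. by have [y [/eqP oxy _]] := qmul_lsolve op x i; exists y. Qed.

Definition track_fun (i x : Q) : Q := xchoose (track_ex i x).

Lemma track_funP (i x : Q) : op x (track_fun i x) = i.
Proof. exact/eqP/(xchooseP (track_ex i x)). Qed.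

Lemma track_fun_inj (i : Q) : injective (track_fun i).
Proof.
move=> x y exy; have [z [_ z_uniq]] := qmul_rsolve op (track_fun i x) i.
by rewrite -(z_uniq x (track_funP i x)) -(z_uniq y) // exy track_funP.
Qed.

Definition track (i : Q) : {perm Q} := perm (@track_fun_inj i).

Lemma trackP (i x : Q) : op x (track i x) = i.
Proof. by rewrite permE track_funP. Qed.

Lemma track_unique (i : Q) (s : {perm Q}) :
  (forall x : Q, op x (s x) = i) -> s = track i.
Proof.
move=> sP; apply/permP => x; have [z [_ z_uniq]] := qmul_lsolve op x i.
by rewrite -(z_uniq _ (sP x)) -(z_uniq _ (trackP i x)).
Qed.

End Tracks.

(* Every element of [porbits s] is the support of one cycle of [s], fixed
   points included as singletons. *)
Definition cycle_type (Q : finType) (s : {perm Q}) : {mset nat} :=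
  seq_mset [seq #|C| | C : {set Q} in porbits s].

Definition special_track (Q : finType) (op : quasigroup Q) (k : Q) : Prop :=
  forall i : Q, i <> k -> cycle_type (track op k) <> cycle_type (track op i).

Definition qaut (Q : finType) (op : quasigroup Q) : {set {perm Q}} :=
  [set a : {perm Q} | [forall x, forall y, a (op x y) == op (a x) (a y)]].

Lemma qautP (Q : finType) (op : quasigroup Q) (a : {perm Q}) :
  reflect (forall x y : Q, a (op x y) = op (a x) (a y)) (a \in qaut op).
Proof.
rewrite inE; apply: (iffP forallP) => [aM x y | aM x].
  by apply/eqP/(forallP (aM x)).
by apply/forallP => y; rewrite aM.
Qed.

Lemma qaut_group_set (Q : finType) (op : quasigroup Q) : group_set (qaut op).
Proof.
apply/group_setP; split=> [|a b /qautP aM /qautP bM].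
  by apply/qautP => x y; rewrite !perm1.
by apply/qautP => x y; rewrite !permM aM bM.
Qed.

Canonical qaut_group (Q : finType) (op : quasigroup Q) : {group {perm Q}} :=
  Group (qaut_group_set op).

(* Main.v *)
(* Conjugating by an automorphism [a] turns the track of [i] into the track of
   [a i], and conjugation preserves cycle types; hence [a] fixes every index of
   a special track, so it commutes with [track op i] and fixes [j]. *)
Require Import Defs.
From mathcomp Require Import all_boot all_fingroup.
From mathcomp Require Import multiset.

Local Open Scope group_scope.

(** Conjugation commutes with powers, so [(s ^ a) ^+ n] sends [a x] to [a ((s ^+ n) x)]. *)
Lemma porbitJ (T : finType) (s a : {perm T}) (x : T) :
  porbit (s ^ a) (a x) = a @: porbit s x.
Proof.
apply/setP => y; apply/porbitP/imsetP => [[n ->]|[z /porbitP[n ->] ->]].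
  by exists ((s ^+ n) x); rewrite ?mem_porbit // -conjXg permJ.
by exists n; rewrite -conjXg permJ.
Qed.

Lemma porbitsJ (T : finType) (s a : {perm T}) :
  porbits (s ^ a) = [set a @: C | C : {set T} in porbits s].
Proof.
apply/setP => C; apply/imsetP/imsetP => [[x _ ->]|[_ /imsetP[x _ ->] ->]].
  by exists (porbit s (a^-1 x)); rewrite ?imset_f // -porbitJ permKV.
by exists (a x); rewrite ?porbitJ.
Qed.

Lemma cycle_typeJ (T : finType) (s a : {perm T}) :
  cycle_type (s ^ a) = cycle_type s.
Proof.
have a_imset_inj : injective (fun C : {set T} => a @: C).
  exact: imset_inj perm_inj.
apply/eq_seq_msetP.
have /(perm_map (fun C : {set T} => #|C|)) : perm_eq
    (enum (porbits (s ^ a))) [seq a @: C | C : {set T} <- enum (porbits s)].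
  (* Distinct cycles have distinct images under [a], so neither list has repetitions and equal
     membership suffices. *)
  apply: uniq_perm; rewrite ?map_inj_uniq ?enum_uniq // => C.
  rewrite mem_enum porbitsJ.
  apply/imsetP/mapP => -[D DP ->]; exists D => //; first by rewrite mem_enum.
  by rewrite -mem_enum.
rewrite -map_comp; congr (perm_eq _ _); apply: eq_map => C /=.
exact/card_imset/perm_inj.
Qed.

Lemma track_qaut (Q : finType) (op : quasigroup Q) (a : {perm Q}) (i : Q) :
  a \in qaut op -> track op (a i) = track op i ^ a.
Proof.
move=> /qautP aM; apply/esym/track_unique => x.
(* With [y = a^-1 x], the product is [op (a y) (a (track op i y))], the image under [a] of [i]. *)
by rewrite -{1 2}(permKV a x) permJ -aM trackP.
Qed.

(** Otherwise [a k] would be a second index whose track has the cycle type of [track op k]. *)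
Lemma special_track_fixed (Q : finType) (op : quasigroup Q) (a : {perm Q})
    (k : Q) :
  special_track op k -> a \in qaut op -> a k = k.
Proof.
move=> k_special aA; apply/eqP/negPn/negP => /eqP /k_special; apply.
by rewrite track_qaut // cycle_typeJ.
Qed.

Theorem proposition1p5 (Q : finType) (op : quasigroup Q) (i j : Q) :
  special_track op i -> special_track op j ->
  forall a : {perm Q}, a \in qaut op -> track op i j = a (track op i j).
Proof.
move=> i_special j_special a aA.
have [ai aj] : a i = i /\ a j = j by split; exact: special_track_fixed aA.
(* Only the left side is rewritten, to [track op (a i) (a j)]. *)
by rewrite -{1}ai -{1}aj track_qaut // permJ.
Qed.
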